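(* Let $n\ge2$ and let $\mathcal{Q}$ be a real symmetric $n\times n$ matrix that is positive semidefinite with $\ker(\mathcal{Q})=\operatorname{span}(\bm{1})$. Let $\Omega$ be the matrix with entries $\Omega_{ab}=(\bm{1}_a-\bm{1}_b)^{\top}\mathcal{Q}^{\dagger}(\bm{1}_a-\bm{1}_b)$. Consider the maximum variance problem $\max_{\bm{f}\in\Delta_n}\tfrac12\bm{f}^{\top}\Omega\bm{f}$, where $\Delta_n=\{\bm{f}\in\mathbb{R}^n:\bm{f}\ge\bm{0},\ \bm{f}^{\top}\bm{1}=1\}$; it has a unique maximizer $\bm{f}^*$, with maximum value $\operatorname{var}^*_R$. Let $\mathcal{V}^*:=\{i\in[n]:f^*_i>0\}$ be its support. For $\mathcal{V}\subseteq[n]$ with $|\mathcal{V}|\ge2$ define $$\bm{p}(\mathcal{V}):=\frac{\Omega[\mathcal{V},\mathcal{V}]^{-1}\bm{1}}{\bm{1}^{\top}\Omega[\mathcal{V},\mathcal{V}]^{-1}\bm{1}},\qquad \sigma^2(\mathcal{V}):=\tfrac12(\bm{1}^{\top}\Omega[\mathcal{V},\mathcal{V}]^{-1}\bm{1})^{-1}.$$ Then $|\mathcal{V}^*|\ge2$, the maximum value equals $\operatorname{var}^*_R=\sigma^2(\mathcal{V}^* )$, and $\bm{f}^*$ is supported on $\mathcal{V}^*$ with $\bm{f}^*[\mathcal{V}^*]=\bm{p}(\mathcal{V}^* )$ (i.e. the resistance curvature of the Kron-reduced graph $\mathcal{G}(\mathcal{Q}/(\mathcal{V}^* )^c)$)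.
   Context: $\mathcal{Q}$ is the Laplacian of a possibly signed undirected graph ($\mathcal{Q}\bm{1}=\bm{0}$, off-diagonal entries of any sign). $\dagger$ is the Moore–Penrose pseudoinverse. $\Omega[\mathcal{V},\mathcal{V}]$ is the principal submatrix indexed by $\mathcal{V}$ (invertible for $|\mathcal{V}|\ge2$), and $\bm{f}^*[\mathcal{V}^*]$ the subvector of $\bm{f}^*$ indexed by $\mathcal{V}^*$. Kron reduction: $\mathcal{Q}/\beta^c:=\mathcal{Q}[\beta,\beta]-\mathcal{Q}[\beta,\beta^c]\mathcal{Q}[\beta^c,\beta^c]^{-1}\mathcal{Q}[\beta^c,\beta]$; its resistance matrix equals $\Omega[\beta,\beta]$. *)

(* Defs.v *)
From HB Require Import structures.
From mathcomp Require Import all_boot all_order all_algebra.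
From mathcomp Require Import boolp classical_sets reals.
Set Implicit Arguments.
Unset Strict Implicit.
Unset Printing Implicit Defensive.
Import Order.TTheory GRing.Theory Num.Theory.
Local Open Scope ring_scope.

Definition ones (R : realType) (m : nat) : 'cV[R]_m := const_mx 1.

Definition qform (R : realType) (m : nat) (A : 'M[R]_m) (x : 'cV[R]_m) : R :=
  (x^T *m A *m x) 0 0.

Definition psd (R : realType) (m : nat) (A : 'M[R]_m) : Prop :=
  forall x : 'cV[R]_m, 0 <= qform A x.

Definition penrose (R : realType) (m n : nat) (A : 'M[R]_(m, n))
    (P : 'M[R]_(n, m)) : Prop :=
  [/\ A *m P *m A = A, P *m A *m P = P,
      (A *m P)^T = A *m P & (P *m A)^T = P *m A].

(* The Moore-Penrose pseudoinverse: the matrix satisfying the four Penrose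
   conditions, which exists and is unique ([mp_pinvP], [mp_pinv_unique]).
   The library's [pinvmx] is only a one-sided generalised inverse. *)
Definition mp_pinv (R : realType) (m n : nat) (A : 'M[R]_(m, n)) :
    'M[R]_(n, m) := xget 0 (penrose A).

Lemma gram_unit (R : realType) (m n : nat) (F : 'M[R]_(m, n)) :
  row_free F -> F *m F^T \in unitmx.
Proof.
move=> freeF; rewrite -row_free_unit -kermx_eq0; apply/eqP/row_matrixP => i.
rewrite row0; set u := row i _.
have uG : u *m (F *m F^T) = 0.
  by apply/sub_kermxP; rewrite row_sub.
apply/(row_free_inj freeF); rewrite mul0mx.
have : (u *m F) *m (u *m F)^T = 0 by rewrite trmx_mul !mulmxA -(mulmxA u) uG mul0mx.
move=> /matrixP/(_ 0 0); rewrite !mxE => /eqP.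
rewrite psumr_eq0 => [|j _]; last by rewrite [_^T _ _]mxE -expr2 sqr_ge0.
move=> /allP h; apply/rowP => j; rewrite [RHS]mxE.
have := h j (mem_index_enum _); rewrite [_^T _ _]mxE /= mulf_eq0 orbb.
by move=> /eqP.
Qed.

Lemma penrose_exists (R : realType) (m n : nat) (A : 'M[R]_(m, n)) :
  exists P, penrose A P.
Proof.
have uF : row_base A *m (row_base A)^T \in unitmx.
  by apply: gram_unit; exact: row_base_free.
have uC : (col_base A)^T *m col_base A \in unitmx.
  rewrite -[X in _ *m X]trmxK; apply: gram_unit.
  by rewrite /row_free mxrank_tr; exact: col_base_full.
have AE := mulmx_base A.
move: (row_base A) (col_base A) uF uC AE; move: (\rank A) => r F C uF uC AE.
subst A.
set iF := invmx (F *m F^T); set iC := invmx (C^T *m C).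
have iFT : iF^T = iF by rewrite /iF trmx_inv trmx_mul trmxK.
have iCT : iC^T = iC by rewrite /iC trmx_inv trmx_mul trmxK.
exists (F^T *m iF *m iC *m C^T).
have AP : C *m F *m (F^T *m iF *m iC *m C^T) = C *m iC *m C^T.
  rewrite !mulmxA -[C *m F *m F^T]mulmxA -[C *m _ *m iF]mulmxA.
  by rewrite mulmxV // mulmx1.
have PA : (F^T *m iF *m iC *m C^T) *m (C *m F) = F^T *m iF *m F.
  rewrite !mulmxA -[_ *m C^T *m C]mulmxA -[_ *m iC *m (_ *m _)]mulmxA.
  by rewrite mulVmx // mulmx1.
split.
- rewrite AP mulmxA -[_ *m C^T *m C]mulmxA -[C *m iC *m _]mulmxA.
  by rewrite mulVmx // mulmx1.
- rewrite PA !mulmxA -[_ *m F *m F^T]mulmxA -[_ *m iF *m (F *m _)]mulmxA.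
  by rewrite mulVmx // mulmx1.
- by rewrite AP !trmx_mul trmxK iCT mulmxA.
- by rewrite PA !trmx_mul trmxK iFT mulmxA.
Qed.

Lemma penrose_unique (R : realType) (m n : nat) (A : 'M[R]_(m, n)) P P' :
  penrose A P -> penrose A P' -> P = P'.
Proof.
move=> [a1 a2 a3 a4] [b1 b2 b3 b4].
have AP : A *m P = A *m P'.
  rewrite -{1}b1 -[LHS]mulmxA -b3 -a3 -trmx_mul.
  by rewrite !mulmxA a1 b3.
have PA : P *m A = P' *m A.
  rewrite -{1}b1 !mulmxA -[X in X *m P' *m A]a4 -mulmxA -b4 -trmx_mul.
  by rewrite -mulmxA [A *m (P *m A)]mulmxA a1 b4.
by rewrite -a2 PA -mulmxA AP mulmxA b2.
Qed.

Lemma mp_pinvP (R : realType) (m n : nat) (A : 'M[R]_(m, n)) :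
  penrose A (mp_pinv A).
Proof. by have [P hP] := penrose_exists A; exact: (xgetPex 0 (ex_intro _ P hP)). Qed.

Lemma mp_pinv_unique (R : realType) (m n : nat) (A : 'M[R]_(m, n)) P :
  penrose A P -> P = mp_pinv A.
Proof. by move=> hP; apply: penrose_unique hP (mp_pinvP A). Qed.

Definition resistance_matrix (R : realType) (m : nat) (Q : 'M[R]_m) : 'M[R]_m :=
  \matrix_(a, b) qform (mp_pinv Q) (delta_mx a 0 - delta_mx b 0).

(* M[A, B], with rows and columns listed in the order of [enum A], [enum B]. *)
Definition submat (R : realType) (n : nat) (A B : {set 'I_n}) (M : 'M[R]_n) :
    'M[R]_(#|A|, #|B|) :=
  \matrix_(i, j) M (enum_val i) (enum_val j).

Definition subvec (R : realType) (n : nat) (A : {set 'I_n}) (f : 'cV[R]_n) :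
    'cV[R]_#|A| :=
  \col_i f (enum_val i) 0.

Definition inv_total (R : realType) (m : nat) (W : 'M[R]_m) : R :=
  ((ones R m)^T *m invmx W *m ones R m) 0 0.

Definition curvature_of (R : realType) (m : nat) (W : 'M[R]_m) : 'cV[R]_m :=
  (inv_total W)^-1 *: (invmx W *m ones R m).

(* The resistance curvature of the (possibly signed) graph with Laplacian Q. *)
Definition resistance_curvature (R : realType) (m : nat) (Q : 'M[R]_m) :
    'cV[R]_m :=
  curvature_of (resistance_matrix Q).

Definition p_vec (R : realType) (n : nat) (Omega : 'M[R]_n) (V : {set 'I_n}) :
    'cV[R]_#|V| :=
  curvature_of (submat V V Omega).

Definition sigma2 (R : realType) (n : nat) (Omega : 'M[R]_n) (V : {set 'I_n}) : R :=
  2^-1 * (inv_total (submat V V Omega))^-1.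

(* Q/beta^c: the Schur complement that keeps the vertices in beta. *)
Definition kron_reduction (R : realType) (n : nat) (Q : 'M[R]_n)
    (beta : {set 'I_n}) : 'M[R]_#|beta| :=
  submat beta beta Q -
  submat beta (~: beta) Q *m invmx (submat (~: beta) (~: beta) Q)
    *m submat (~: beta) beta Q.

Definition in_simplex (R : realType) (n : nat) (f : 'cV[R]_n) : Prop :=
  (forall i, 0 <= f i 0) /\ (f^T *m ones R n) 0 0 = 1.

Definition variance (R : realType) (n : nat) (Omega : 'M[R]_n) (f : 'cV[R]_n) : R :=
  2^-1 * qform Omega f.

Definition is_maximizer (R : realType) (n : nat) (Omega : 'M[R]_n)
    (f : 'cV[R]_n) : Prop :=
  in_simplex f /\ forall g, in_simplex g -> variance Omega g <= variance Omega f.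

Definition pos_support (R : realType) (n : nat) (f : 'cV[R]_n) : {set 'I_n} :=
  [set i | 0 < f i 0]%SET.

(* Main.v *)
(* Writing [P] for the pseudoinverse of [Q] and [d] for its diagonal, the
   resistance matrix is [d 1^T + 1 d^T - 2 P], so its quadratic form is negative
   definite on vectors of total zero, and so is that of every principal
   submatrix. This yields invertibility, and strict concavity on the simplex
   gives uniqueness of the maximizer. First-order optimality says that [Omega f]
   is constant on the support [V] of the maximizer, so [f] restricted to [V] is
   proportional to [Omega[V,V]^-1 1]. The resistance matrix of the Kron reduction
   is [Omega[V,V]] because restricting to [V] the potential [P E z] of a current
   [z] injected in [V] solves the reduced system. *)
Require Import Defs.
From mathcomp Require Import all_boot all_order all_algebra.
From mathcomp Require Import boolp classical_sets reals.
From mathcomp Require Import topology normedtype derive.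
From mathcomp Require Import ring lra.
Set Implicit Arguments.
Unset Strict Implicit.
Unset Printing Implicit Defensive.
Import Order.TTheory GRing.Theory Num.Theory numFieldNormedType.Exports.
Local Open Scope ring_scope.

(** * Quadratic and bilinear forms, and definiteness on vectors of total zero *)

Definition bform (R : realType) (m : nat) (A : 'M[R]_m) (x y : 'cV[R]_m) : R :=
  (x^T *m A *m y) 0 0.

Definition total (R : realType) (m : nat) (x : 'cV[R]_m) : R :=
  ((ones R m)^T *m x) 0 0.

(** Strict conditional negative definiteness, as for squared Euclidean distances between affinely
    independent points. *)
Definition cond_negdef (R : realType) (m : nat) (W : 'M[R]_m) : Prop :=
  forall x : 'cV[R]_m, total x = 0 -> x != 0 -> qform W x < 0.

Lemma quad_ge0_lin_eq0 (R : realType) (b q : R) :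
  0 <= q -> (forall t, 0 <= 2 * t * b + t ^+ 2 * q) -> b = 0.
Proof.
(* The minimiser would be [- b / q]; the shift to [q + 1] also covers [q = 0], and the value keeps
   the sign of [- b ^+ 2]. *)
move=> q0 /(_ (- b / (q + 1))).
have q1 : 0 < q + 1 by lra.
rewrite -(pmulr_lge0 _ (_ : 0 < (q + 1) ^+ 2)) ?exprn_gt0 //.
rewrite [X in 0 <= X](_ : _ = - (b ^+ 2 * (q + 2))); last by field; lra.
rewrite oppr_ge0 pmulr_lle0; last lra.
by move=> b2; apply/eqP; rewrite -sqrf_eq0 eq_le b2 sqr_ge0.
Qed.

Section Forms.
Variables (R : realType) (m : nat).
Implicit Types (A W : 'M[R]_m) (x y z : 'cV[R]_m).

Lemma bform_sym A x y : A^T = A -> bform A x y = bform A y x.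
Proof.
move=> sA; rewrite /bform -[RHS]trace_mx11 -mxtrace_tr trace_mx11.
by rewrite !trmx_mul trmxK sA mulmxA.
Qed.

Lemma qformDZ A x y (t : R) : A^T = A ->
  qform A (x + t *: y) = qform A x + 2 * t * bform A x y + t ^+ 2 * qform A y.
Proof.
move=> sA; have := bform_sym y x sA; rewrite /bform /qform => h.
rewrite [(x + _)^T]linearD /= [(t *: y)^T]linearZ /= !(mulmxDl, mulmxDr).
rewrite -!(scalemxAl, scalemxAr) !mxE.
by move: h; rewrite !mxE => ->; ring.
Qed.

Lemma qformZ A x (t : R) : qform A (t *: x) = t ^+ 2 * qform A x.
Proof.
by rewrite /qform [(t *: x)^T]linearZ /= -!(scalemxAl, scalemxAr) 2!mxE; ring.
Qed.

Lemma qform_mulmx (k : nat) A (B : 'M[R]_(m, k)) (x : 'cV[R]_k) :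
  qform A (B *m x) = qform (B^T *m A *m B) x.
Proof. by rewrite /qform trmx_mul !mulmxA. Qed.

Lemma bform_delta A x i : bform A (delta_mx i 0) x = (A *m x) i 0.
Proof. by rewrite /bform trmx_delta -mulmxA -rowE !mxE. Qed.

Lemma totalE x : total x = \sum_i x i 0.
Proof. by rewrite /total mxE; apply: eq_bigr => i _; rewrite !mxE mul1r. Qed.

Lemma total_trmx x : (x^T *m ones R m) 0 0 = total x.
Proof. by rewrite totalE mxE; apply: eq_bigr => i _; rewrite !mxE mulr1. Qed.

Lemma totalD x y : total (x + y) = total x + total y.
Proof. by rewrite /total mulmxDr mxE. Qed.

Lemma totalZ (t : R) x : total (t *: x) = t * total x.
Proof. by rewrite /total -scalemxAr mxE. Qed.

Lemma totalB x y : total (x - y) = total x - total y.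
Proof. by rewrite totalD -scaleN1r totalZ mulN1r. Qed.

Lemma total_delta i : total (delta_mx i 0 : 'cV[R]_m) = 1.
Proof.
rewrite totalE (bigD1 i) //= big1 => [|j ji]; rewrite !mxE ?eqxx ?addr0 //.
by rewrite (negbTE ji).
Qed.

Lemma sqnorm_eq0 x : (x^T *m x) 0 0 = 0 -> x = 0.
Proof.
rewrite mxE => /eqP; rewrite psumr_eq0 => [/allP h|i _].
  apply/colP => i; have := h i (mem_index_enum _).
  by rewrite !mxE /= mulf_eq0 orbb => /eqP.
by rewrite mxE -expr2 sqr_ge0.
Qed.

(** [x] minimises the form, so the linear term along the direction [A *m x] vanishes; that term is
    the squared norm of [A *m x]. *)
Lemma psd_ker A x : A^T = A -> psd A -> qform A x = 0 -> A *m x = 0.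
Proof.
move=> sA pA qx; apply: sqnorm_eq0.
set y := A *m x; set q := qform A y.
have q0 : 0 <= q by exact: pA.
have -> : (y^T *m y) 0 0 = bform A x y.
  by rewrite (bform_sym _ _ sA) /bform -mulmxA.
apply: (quad_ge0_lin_eq0 q0) => t; have := pA (x + t *: y).
by rewrite qformDZ // qx add0r.
Qed.

Lemma ker_unitmx A : (forall x, A *m x = 0 -> x = 0) -> A \in unitmx.
Proof.
move=> kA; rewrite -unitmx_tr -row_free_unit -kermx_eq0.
apply/eqP/row_matrixP => i; rewrite row0; apply: trmx_inj; rewrite trmx0.
apply: kA; apply: trmx_inj; rewrite trmx_mul trmxK trmx0.
by apply/sub_kermxP; rewrite row_sub.
Qed.

(** * Invertibility; the witness [y] excludes singular cases such as the zero matrix of size one *)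

Section CondNegDef.
Variables (W : 'M[R]_m) (y : 'cV[R]_m).
Hypotheses (sW : W^T = W) (nW : cond_negdef W).
Hypotheses (y1 : total y = 1) (qy : 0 < qform W y).

Lemma cond_negdef_le0 x : total x = 0 -> qform W x <= 0.
Proof.
move=> x0; have [->|xn0] := eqVneq x 0; last exact/ltW/nW.
by rewrite /qform mulmx0 mxE.
Qed.

(* A kernel vector x is W-orthogonal to y, so y - x would be a vector of total
   zero with the same positive value as y if x had total one. *)
Lemma cond_negdef_unit : W \in unitmx.
Proof.
apply: ker_unitmx => x Wx.
have qx : qform W x = 0 by rewrite /qform -mulmxA Wx mulmx0 mxE.
have [x0|xn0] := eqVneq (total x) 0.
  by apply/eqP; apply: contraT => /(nW x0); rewrite qx ltxx.
suff : qform W (y + (- (total x)^-1) *: x) <= 0.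
  rewrite qformDZ // qx /bform -mulmxA Wx mulmx0 mxE !mulr0 !addr0.
  by rewrite leNgt qy.
by apply: cond_negdef_le0; rewrite totalD totalZ y1 mulNr mulVf ?subrr.
Qed.

(** With [u] the solution of [W u = 1], both the total of [u] and its form equal [inv_total W]. If
    this were zero, definiteness would give [u = 0], hence [1 = W u = 0], against [total y = 1]. *)
Lemma cond_negdef_inv_total : inv_total W != 0.
Proof.
have uW := cond_negdef_unit; apply/eqP; rewrite /inv_total -mulmxA.
set u := invmx W *m _ => u0.
have Wu : W *m u = ones R m by rewrite mulmxA mulmxV // mul1mx.
have qu : qform W u = 0 by rewrite /qform -mulmxA Wu total_trmx.
have u_eq0 : u = 0.
  by apply/eqP; apply: contraT => /(nW u0); rewrite qu ltxx.
have := y1; rewrite /total -Wu u_eq0 mulmx0 trmx0 mul0mx mxE.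
by move/eqP; rewrite eq_sym oner_eq0.
Qed.

End CondNegDef.

End Forms.

(** * Principal submatrices through coordinate embeddings *)

Section Embedding.
Variables (R : realType) (n : nat).
Implicit Types (A B V : {set 'I_n}) (M : 'M[R]_n).

(** Extension by zero from [V]; its transpose is restriction to [V]. Submatrices thus become
    products, and their forms are pulled back along [emb V]. *)
Definition emb V : 'M[R]_(n, #|V|) := \matrix_(i, j) (i == enum_val j)%:R.

Lemma mul_embE (k : nat) V (M : 'M[R]_(k, n)) i j :
  (M *m emb V) i j = M i (enum_val j).
Proof.
rewrite mxE (bigD1 (enum_val j)) //= big1 => [|l lj]; rewrite !mxE.
  by rewrite eqxx mulr1 addr0.
by rewrite (negbTE lj) mulr0.
Qed.

Lemma mul_trembE (k : nat) V (M : 'M[R]_(n, k)) i j :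
  ((emb V)^T *m M) i j = M (enum_val i) j.
Proof.
by have := mul_embE M^T j i; rewrite -[emb V]trmxK -trmx_mul !trmxK !mxE.
Qed.

Lemma submat_emb A B M : submat A B M = (emb A)^T *m M *m emb B.
Proof. by apply/matrixP => i j; rewrite mul_embE mul_trembE mxE. Qed.

Lemma subvec_emb V f : subvec V f = (emb V)^T *m f.
Proof. by apply/colP => i; rewrite mul_trembE mxE. Qed.

Lemma embK V (k : nat) (M : 'M[R]_(#|V|, k)) : (emb V)^T *m (emb V *m M) = M.
Proof.
rewrite mulmxA [_ *m emb V](_ : _ = 1%:M) ?mul1mx //.
by apply/matrixP => i j; rewrite mul_embE !mxE (inj_eq enum_val_inj) eq_sym.
Qed.

Lemma emb_delta V i :
  emb V *m delta_mx i 0 = delta_mx (enum_val i) 0 :> 'cV[R]_n.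
Proof. by rewrite -colE; apply/colP => j; rewrite !mxE andbT. Qed.

Lemma total_emb V x : total (emb V *m x) = total x.
Proof.
rewrite /total mulmxA [_ *m emb V](_ : _ = (ones R #|V|)^T) //.
by apply/rowP => j; rewrite mul_embE !mxE.
Qed.

Lemma emb_proj V : emb V *m (emb V)^T = diag_mx (\row_i (i \in V)%:R).
Proof.
apply/matrixP => i k; rewrite !mxE.
under eq_bigr do rewrite !mxE -natrM mulnb.
rewrite -(big_enum_val (fun j => ((i == j) && (k == j))%:R)) /=.
have [<-|ik] := eqVneq i k.
  rewrite mulr1n; under eq_bigr do rewrite andbb.
  have [iV|iV] := boolP (i \in V).
    rewrite (bigD1 i) //= eqxx big1 ?addr0 // => j /andP[_ ji].
    by rewrite eq_sym (negbTE ji).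
  rewrite big1 // => j jV; case: eqP => // ij.
  by rewrite ij jV in iV.
rewrite mulr0n big1 // => j _; case: eqP => [<-|//].
by rewrite eq_sym (negbTE ik).
Qed.

Lemma emb_split V : emb V *m (emb V)^T + emb (~: V) *m (emb (~: V))^T = 1%:M.
Proof.
rewrite !emb_proj -linearD /= -diag_const_mx; congr diag_mx.
by apply/rowP => i; rewrite !mxE inE; case: (i \in V); rewrite ?addr0 ?add0r.
Qed.

Lemma emb_supp V (f : 'cV[R]_n) :
  (forall i, i \notin V -> f i 0 = 0) -> emb V *m (emb V)^T *m f = f.
Proof.
move=> h; rewrite emb_proj mul_diag_mx; apply/colP => i; rewrite !mxE.
by have [|/h ->] := boolP (i \in V); rewrite ?mul1r ?mulr0.
Qed.

End Embedding.

(** * A point of the simplex with positive form *)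

Section PositiveMidpoint.
Variables (R : realType) (m : nat) (W : 'M[R]_m).
Hypotheses (m2 : (2 <= m)%N) (sW : W^T = W) (W0 : forall i, W i i = 0).
Hypothesis Wpos : forall i j, i != j -> 0 < W i j.

(** The midpoint of two vertices [i] and [j] has form [W i j / 2], since the diagonal terms
    vanish. *)
Lemma exists_simplex_qform_gt0 : exists y, in_simplex y /\ 0 < qform W y.
Proof.
pose i : 'I_m := Ordinal (ltnW m2); pose j : 'I_m := Ordinal m2.
exists (2^-1 *: (delta_mx i 0 + 1 *: delta_mx j 0)); split; first split.
- by move=> k; rewrite !mxE mul1r mulr_ge0 ?addr_ge0 ?ler0n ?invr_ge0.
- by rewrite total_trmx totalZ totalD totalZ !total_delta; lra.
rewrite qformZ qformDZ //.
have bE k l : bform W (delta_mx k 0) (delta_mx l 0) = W k l.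
  by rewrite bform_delta -colE mxE.
have qE k : qform W (delta_mx k 0) = 0 by rewrite -[RHS](W0 k) -bE.
rewrite !qE bE; have : 0 < W i j by exact: Wpos.
lra.
Qed.

End PositiveMidpoint.

(** * Optimality conditions and uniqueness on the simplex *)

Section Maximizer.
Variables (R : realType) (n : nat) (W : 'M[R]_n).
Hypothesis sW : W^T = W.

Lemma is_maximizerP (f : 'cV[R]_n) : is_maximizer W f <->
  in_simplex f /\ forall g, in_simplex g -> qform W g <= qform W f.
Proof.
by split=> -[sf mf]; split=> // g /mf; rewrite /variance ler_pM2l ?invr_gt0.
Qed.

Lemma quad_le0_lin_le0 (c D q : R) : 0 < c ->
  (forall t, 0 <= t -> t <= c -> 2 * t * D + t ^+ 2 * q <= 0) -> D <= 0.
Proof.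
move=> c0 h; rewrite leNgt; apply/negP => D0.
have r0 : 0 < `|q| + 1 by rewrite ltr_wpDl.
(* This step is feasible and small enough that [t * |q| < D], so the linear term dominates. *)
pose t := Num.min c (D / (`|q| + 1)).
have t0 : 0 < t by rewrite lt_min c0 divr_gt0.
have tc : t <= c by rewrite ge_min lexx.
have tD : t * (`|q| + 1) <= D by rewrite -ler_pdivlMr // ge_min lexx orbT.
have qr : - `|q| <= q by rewrite lerNl -normrN ler_norm.
have := h t (ltW t0) tc; nra.
Qed.

(** Moving mass [t] from [j] to [i] stays in the simplex for [0 <= t <= f j 0], so the first-order
    change cannot be positive. Used in both directions, this makes [W *m f] constant on the
    support. *)
Lemma maximizer_kkt (f : 'cV[R]_n) i j :
  is_maximizer W f -> 0 < f j 0 -> (W *m f) i 0 <= (W *m f) j 0.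
Proof.
move=> /is_maximizerP[[f0 f1] mf] fj; rewrite -subr_le0.
pose z : 'cV[R]_n := delta_mx i 0 - delta_mx j 0.
apply: (@quad_le0_lin_le0 (f j 0) _ (qform W z)) => // t t0 tf.
have <- : bform W f z = (W *m f) i 0 - (W *m f) j 0.
  rewrite bform_sym // -!bform_delta /bform linearB /= !mulmxBl mxE.
  by rewrite [X in _ + X]mxE.
suff /mf : in_simplex (f + t *: z) by rewrite qformDZ //; lra.
split=> [k|]; last first.
  rewrite total_trmx totalD totalZ totalB !total_delta subrr mulr0 addr0.
  by rewrite -total_trmx.
rewrite !mxE !andbT; have := f0 k.
have [->|_] := eqVneq k j; case: (_ == i); rewrite ?mulr0n ?mulr1n; lra.
Qed.

(** The form is strictly concave along [g - f], which has total zero, so the midpoint of two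
    distinct maximizers would beat both. *)
Lemma maximizer_unique (f g : 'cV[R]_n) :
  cond_negdef W -> is_maximizer W f -> is_maximizer W g -> f = g.
Proof.
move=> nW /is_maximizerP[[f0 f1] mf] /is_maximizerP[[g0 g1] mg].
apply/eqP; apply: contraT; rewrite eq_sym -subr_eq0 => gf.
have t0 : total (g - f) = 0.
  by rewrite totalB -!total_trmx f1 g1 subrr.
have q0 := nW _ t0 gf.
have gE : g = f + 1 *: (g - f) by rewrite scale1r addrC subrK.
have /mf : in_simplex (f + 2^-1 *: (g - f)).
  split=> [k|]; last first.
    by rewrite total_trmx totalD totalZ t0 mulr0 addr0 -total_trmx.
  by rewrite !mxE; have := f0 k; have := g0 k; lra.
have : qform W f <= qform W g by apply: mg.
rewrite [in qform W g]gE !qformDZ // ; lra.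
Qed.

Lemma maximizer_curvature (f : 'cV[R]_n) (V := pos_support f) :
    is_maximizer W f -> submat V V W \in unitmx ->
  subvec V f = p_vec W V /\ variance W f = sigma2 W V.
Proof.
move=> mf uW; have [sf _] := mf; have [f0 f1] := sf.
have fE : emb R V *m (emb R V)^T *m f = f.
  apply: emb_supp => i; rewrite inE -leNgt => fi.
  by apply/eqP; rewrite eq_le fi f0.
have t1 : total (subvec V f) = 1.
  by rewrite subvec_emb -total_emb mulmxA fE -total_trmx.
(* Total one excludes an empty support; [k] serves to read off the multiplier [lam]. *)
have [k|V0] := pickP (fun k : 'I_#|V| => true); last first.
  have := t1; rewrite totalE big1 ?(rwP eqP) 1?eq_sym ?oner_eq0 // => k.
  by have := V0 k.
pose lam := (W *m f) (enum_val k) 0.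
have We : submat V V W *m subvec V f = lam *: ones R #|V|.
  rewrite submat_emb subvec_emb -!mulmxA [emb R V *m _]mulmxA fE.
  apply/colP => i; rewrite mul_trembE [RHS]mxE [ones _ _ _ _]mxE mulr1.
  have Vpos l : 0 < f (@enum_val _ (mem V) l) 0.
    by have := enum_valP l; rewrite inE.
  by apply/eqP; rewrite eq_le !maximizer_kkt.
have fV : subvec V f = lam *: (invmx (submat V V W) *m ones R #|V|).
  by rewrite scalemxAr -We mulmxA mulVmx // mul1mx.
(* Normalising the total of [f] to one determines [lam], and shows that [inv_total] is nonzero. *)
have lamE : lam * inv_total (submat V V W) = 1.
  by rewrite -t1 fV totalZ /inv_total -mulmxA.
have it0 : inv_total (submat V V W) != 0.
  apply/eqP => it0; move: lamE; rewrite it0 mulr0 => /eqP.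
  by rewrite eq_sym oner_eq0.
have lamV : lam = (inv_total (submat V V W))^-1.
  by apply: (mulIf it0); rewrite lamE mulVf.
split; first by rewrite fV lamV.
rewrite /variance /sigma2 -lamV; congr (_ * _).
rewrite -[in LHS]fE -mulmxA -subvec_emb qform_mulmx -submat_emb.
by rewrite /qform -mulmxA We -scalemxAr mxE total_trmx t1 mulr1.
Qed.

End Maximizer.

(** * Pseudoinverse and resistance matrix of a Laplacian *)

Section Laplacian.
Variables (R : realType) (n : nat) (Q : 'M[R]_n).
Hypotheses (Qsym : Q^T = Q) (Qpsd : psd Q).

Local Notation P := (mp_pinv Q).
Local Notation Omega := (resistance_matrix Q).

(** The transpose of [P] also satisfies the Penrose conditions for the symmetric [Q], with the last
    two exchanged; uniqueness concludes. *)
Lemma pinv_sym : P^T = P.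
Proof.
have [a1 a2 a3 a4] := mp_pinvP Q.
have QP : Q *m P^T = P *m Q by rewrite -a4 trmx_mul Qsym.
have PQ : P^T *m Q = Q *m P by rewrite -a3 trmx_mul Qsym.
apply: mp_pinv_unique; split; [| |by rewrite QP|by rewrite PQ].
- by apply: trmx_inj; rewrite !trmx_mul trmxK Qsym mulmxA a1.
- by apply: trmx_inj; rewrite !trmx_mul trmxK Qsym mulmxA a2.
Qed.

Lemma pinv_comm : Q *m P = P *m Q.
Proof. by have [_ _ <- _] := mp_pinvP Q; rewrite trmx_mul pinv_sym Qsym. Qed.

Lemma qform_pinv x : qform P x = qform Q (P *m x).
Proof.
have [_ a2 _ _] := mp_pinvP Q.
by rewrite qform_mulmx pinv_sym a2.
Qed.

Lemma resistance_matrixE a b : Omega a b = P a a + P b b - 2 * P a b.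
Proof.
have bE k l : bform P (delta_mx k 0) (delta_mx l 0) = P k l.
  by rewrite bform_delta -colE mxE.
rewrite mxE -[- delta_mx b 0]scaleN1r qformDZ ?pinv_sym //.
by rewrite ![qform _ (delta_mx _ _)]bE bE; ring.
Qed.

Lemma resistance_sym : Omega^T = Omega.
Proof.
apply/matrixP => a b; rewrite mxE !resistance_matrixE.
by rewrite -[in P b a]pinv_sym mxE; ring.
Qed.

Lemma resistance_diag a : Omega a a = 0.
Proof. by rewrite resistance_matrixE; ring. Qed.

Lemma qform_resistance x : total x = 0 -> qform Omega x = - 2 * qform P x.
Proof.
move=> x0; pose d : 'cV[R]_n := \col_i P i i.
have -> : Omega = d *m (ones R n)^T + ones R n *m d^T - 2 *: P.
  apply/matrixP => a b; rewrite resistance_matrixE.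
  by rewrite !mxE !big_ord1 !mxE; ring.
have x1 : (ones R n)^T *m x = 0 by apply/rowP => i; rewrite !ord1 [LHS]x0 mxE.
have x2 : x^T *m ones R n = 0.
  by apply: trmx_inj; rewrite trmx_mul trmxK x1 !trmx0.
rewrite /qform mulmxBr mulmxDr !mulmxA x2 mul0mx addr0 mulmxBl.
rewrite -(mulmxA (x^T *m d)) x1.
by rewrite mulmx0 sub0r -scalemxAr -scalemxAl !mxE mulNr.
Qed.

Lemma kron_sym V : (kron_reduction Q V)^T = kron_reduction Q V.
Proof.
have tr A B : (submat A B Q)^T = submat B A Q.
  by rewrite !submat_emb !trmx_mul trmxK Qsym mulmxA.
by rewrite /kron_reduction linearB /= !trmx_mul trmx_inv !tr mulmxA.
Qed.

Section Kernel.
Hypothesis Qker : forall x : 'cV[R]_n,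
  Q *m x = 0 <-> exists c : R, x = c *: ones R n.

Lemma laplacian_ones : Q *m ones R n = 0.
Proof. by apply/Qker; exists 1; rewrite scale1r. Qed.

(** [Q *m P] projects onto the vectors of total zero: the residual lies in the kernel of [Q], hence
    is constant, and its total is zero. *)
Lemma pinv_right_inv x : total x = 0 -> Q *m (P *m x) = x.
Proof.
move=> x0; have [a1 _ _ _] := mp_pinvP Q.
have /Qker[c xE] : Q *m (x - Q *m (P *m x)) = 0.
  by rewrite mulmxBr [Q *m (P *m x)]mulmxA pinv_comm !mulmxA a1 subrr.
have : total (x - Q *m (P *m x)) = 0.
  have oQ : (ones R n)^T *m Q = 0.
    by apply: trmx_inj; rewrite trmx_mul trmxK Qsym laplacian_ones trmx0.
  by rewrite totalB x0 sub0r /total mulmxA oQ mul0mx mxE oppr0.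
rewrite xE totalZ totalE; under eq_bigr do rewrite mxE.
rewrite sumr_const card_ord => /eqP; rewrite mulf_eq0 => /orP[/eqP c0|].
  by move: xE; rewrite c0 scale0r => /eqP; rewrite subr_eq0 => /eqP.
(* In the remaining case [n = 0] there is no coordinate to compare. *)
rewrite pnatr_eq0 => /eqP n0; apply/colP => -[i i_n]; exfalso.
by move: i_n; rewrite n0.
Qed.

(** The form of [P] at [x] is the energy of the potential [P *m x]; if it vanishes, so does
    [Q *m (P *m x)], which is [x]. *)
Lemma pinv_posdef x : total x = 0 -> x != 0 -> 0 < qform P x.
Proof.
move=> x0 xn0; rewrite lt_def qform_pinv Qpsd andbT.
apply: contra xn0 => /eqP/(psd_ker Qsym Qpsd).
by rewrite pinv_right_inv // => ->.
Qed.

Lemma resistance_cond_negdef : cond_negdef Omega.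
Proof.
move=> x x0 xn0; rewrite qform_resistance //.
by have := pinv_posdef x0 xn0; lra.
Qed.

Lemma resistance_gt0 a b : a != b -> 0 < Omega a b.
Proof.
move=> ab; rewrite mxE; apply: pinv_posdef.
  by rewrite totalB !total_delta subrr.
apply/eqP => /colP/(_ a); rewrite !mxE eqxx (negbTE ab) subr0 => /eqP.
by rewrite oner_eq0.
Qed.

(** * Principal blocks and the Kron reduction *)

Section Subset.
Variable V : {set 'I_n}.
Local Notation W := (submat V V Omega).

Lemma sub_resistance_sym : W^T = W.
Proof. by rewrite submat_emb !trmx_mul trmxK resistance_sym mulmxA. Qed.

Lemma sub_resistance_cond_negdef : cond_negdef W.
Proof.
move=> x x0 xn0; rewrite submat_emb -qform_mulmx.
apply: resistance_cond_negdef; first by rewrite total_emb.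
by apply: contra xn0 => /eqP h; rewrite -[x]embK h mulmx0.
Qed.

Lemma sub_resistance_positive : (2 <= #|V|)%N ->
  exists y, in_simplex y /\ 0 < qform W y.
Proof.
move=> V2; apply: exists_simplex_qform_gt0 => //.
- exact: sub_resistance_sym.
- by move=> i; rewrite mxE resistance_diag.
- by move=> i j ij; rewrite mxE resistance_gt0 // (inj_eq enum_val_inj).
Qed.

Lemma sub_resistance_unit : (2 <= #|V|)%N -> W \in unitmx.
Proof.
move=> /sub_resistance_positive[y [[_ y1] qy]]; rewrite total_trmx in y1.
exact: cond_negdef_unit sub_resistance_sym sub_resistance_cond_negdef y1 qy.
Qed.

Lemma sub_resistance_inv_total : (2 <= #|V|)%N -> inv_total W != 0.
Proof.
move=> /sub_resistance_positive[y [[_ y1] qy]]; rewrite total_trmx in y1.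
exact: cond_negdef_inv_total sub_resistance_sym
  sub_resistance_cond_negdef y1 qy.
Qed.

Hypothesis V0 : (0 < #|V|)%N.

(** A kernel vector extended by zero has zero energy, hence is constant; it vanishes at a vertex of
    [V], so the constant is zero. *)
Lemma sub_laplacian_unit : submat (~: V) (~: V) Q \in unitmx.
Proof.
apply: ker_unitmx => x; rewrite submat_emb => hx.
have q0 : qform Q (emb R (~: V) *m x) = 0.
  by rewrite qform_mulmx /qform -mulmxA hx mulmx0 mxE.
have /Qker[c xE] := psd_ker Qsym Qpsd q0.
have c0 : c = 0.
  have /card_gt0P[v vV] := V0.
  have /colP/(_ v) := xE; rewrite !mxE mulr1 => <-.
  apply: big1 => j _; rewrite mxE; case: eqP => [vE|]; rewrite ?mul0r //.
  by have := enum_valP j; rewrite -vE inE vV.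
by rewrite -[x]embK xE c0 scale0r mulmx0.
Qed.

(** The potential [x] satisfies [Q x = E z], with no current outside [V]. Those equations express
    the outer part of [x] through its part on [V]; substitution leaves the Schur complement. *)
Lemma kron_potential (z : 'cV[R]_#|V|) : total z = 0 ->
  kron_reduction Q V *m ((emb R V)^T *m (P *m (emb R V *m z))) = z.
Proof.
move=> z0; set x := P *m _.
have Qx : Q *m x = emb R V *m z by rewrite pinv_right_inv ?total_emb.
have uC := sub_laplacian_unit.
rewrite /kron_reduction mulmxBl -!mulmxA.
rewrite [submat V V Q]submat_emb [submat (~: V) V Q]submat_emb.
rewrite -!mulmxA ![emb R V *m (_ *m x)]mulmxA.
(* Trading the projection onto [V] for the complementary one makes [Q *m x] appear, which is
   known. *)
have -> : emb R V *m (emb R V)^T = 1%:M - emb R (~: V) *m (emb R (~: V))^T.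
  by rewrite -(emb_split R V) addrK.
rewrite mulmxBl mul1mx mulmxBr Qx !mulmxBr embK.
have -> : (emb R (~: V))^T *m (emb R V *m z) = 0.
  rewrite mulmxA [_ *m emb R V](_ : _ = 0) ?mul0mx //.
  apply/matrixP => i j; rewrite mul_embE !mxE; case: eqP => // ij.
  by have := enum_valP i; rewrite inE -ij enum_valP.
rewrite !mulmx0 sub0r opprK -!mulmxA.
have -> : invmx (submat (~: V) (~: V) Q) *m
    ((emb R (~: V))^T *m (Q *m (emb R (~: V) *m ((emb R (~: V))^T *m x))))
    = (emb R (~: V))^T *m x.
  by rewrite 2!(mulmxA (emb R (~: V))^T) 1!mulmxA -submat_emb mulKmx.
by rewrite submat_emb -!mulmxA subrK.
Qed.

(** Writing [K] for the reduction, [z = K u] with [u] the restricted potential. Then [K] times its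
    pseudoinverse times [K] collapses to [K], and the form at [z] becomes the pairing of [u] with
    [z], which is the form of [P] at the extension of [z]. *)
Lemma resistance_kron : resistance_matrix (kron_reduction Q V) = W.
Proof.
apply/matrixP => a b; rewrite mxE [RHS]mxE [RHS]mxE.
pose z : 'cV[R]_#|V| := delta_mx a 0 - delta_mx b 0; rewrite -/z.
have z0 : total z = 0 by rewrite totalB !total_delta subrr.
rewrite -!emb_delta -mulmxBr -/z qform_mulmx.
set u := (emb R V)^T *m (P *m (emb R V *m z)).
have Ku : kron_reduction Q V *m u = z by exact: kron_potential.
have [k1 _ _ _] := mp_pinvP (kron_reduction Q V).
rewrite -[in LHS]Ku qform_mulmx kron_sym k1 /qform -mulmxA Ku.
rewrite (_ : u^T = z^T *m ((emb R V)^T *m P *m emb R V)) //.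
by rewrite /u !trmx_mul trmxK pinv_sym !mulmxA.
Qed.

End Subset.

(** On at most one vertex the form only sees the zero diagonal, whereas a midpoint of two vertices
    has a positive value. *)
Lemma maximizer_support_ge2 f : (2 <= n)%N ->
  is_maximizer Omega f -> (2 <= #|pos_support f|)%N.
Proof.
move=> n2 /is_maximizerP[[f0 _] mf]; rewrite ltnNge; apply/negP => V1.
have [y [sy qy]] :=
  exists_simplex_qform_gt0 n2 resistance_sym resistance_diag resistance_gt0.
have := mf y sy; rewrite leNgt => /negP; apply; apply: le_lt_trans qy.
set V := pos_support f in V1.
have <- : emb R V *m (emb R V)^T *m f = f.
  apply: emb_supp => i; rewrite inE -leNgt => fi.
  by apply/eqP; rewrite eq_le fi f0.
rewrite -mulmxA qform_mulmx -submat_emb.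
have -> : submat V V Omega = 0.
  apply/matrixP => i j; rewrite !mxE -(resistance_diag (enum_val i)) mxE.
  by rewrite (card_le1_eqP V1 _ _ (enum_valP i) (enum_valP j)).
by rewrite /qform mulmx0 mul0mx mxE.
Qed.

End Kernel.
End Laplacian.

(** * Existence of a maximizer by compactness *)

Lemma continuous_mul (R : realType) (T : topologicalType) (F G : T -> R) :
  continuous F -> continuous G -> continuous (fun v => F v * G v).
Proof. by move=> cF cG v; apply: cvgM; [exact: cF|exact: cG]. Qed.

Lemma continuous_sum (R : realType) (T : topologicalType) (n : nat)
    (F : 'I_n -> T -> R) :
  (forall i, continuous (F i)) -> continuous (fun v => \sum_i F i v).
Proof. by move=> cF; apply: continuous_big => //; exact: add_continuous. Qed.

Lemma maximizer_exists (R : realType) (n : nat) (W : 'M[R]_n) :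
  (0 < n)%N -> exists f, is_maximizer W f.
Proof.
move=> n0.
(* The simplex as a closed subset of the unit cube, in row vectors to match [rV_compact] and
   [EVT_max_rV]. *)
pose A : set 'rV[R]_n :=
  ([set v | forall i, `[0, 1]%classic (v ord0 i)] `&`
   [set v | \sum_i v ord0 i = 1])%classic.
have sumE (v : 'rV[R]_n) : (v *m ones R n) 0 0 = \sum_i v 0 i.
  by rewrite mxE; apply: eq_bigr => i _; rewrite mxE mulr1.
have AP v : A v <-> in_simplex v^T.
  rewrite /in_simplex trmxK sumE; split=> -[v0 v1]; split=> // i.
    by have /= := v0 i; rewrite mxE in_itv /= => /andP[].
  have {}v0 k : 0 <= v 0 k by have := v0 k; rewrite mxE.
  (* The upper bound holds because a nonnegative coordinate is at most the total. *)
  rewrite /= in_itv /= v0 -v1 (bigD1 i) //= lerDl.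
  by apply: sumr_ge0 => k _.
have contcoord i : continuous (fun v : 'rV[R]_n => v ord0 i).
  exact: coord_continuous.
have cA : compact A.
  apply: compact_closedI.
    apply: (@rV_compact R n (fun=> `[0, 1]%classic)) => i.
    exact: segment_compact.
  apply: (@preimage_closed _ _ (fun v : 'rV[R]_n => \sum_i v ord0 i)
    [set 1]%classic).
    by move=> v _; apply: continuous_sum.
  exact: closed_eq.
have [||c /set_mem/AP cA' cmax] :=
  @EVT_max_rV R n (fun v => variance W v^T) A _ cA.
- exists (delta_mx 0 (Ordinal n0)); apply/AP.
  rewrite /in_simplex trmxK sumE; split=> [i|]; first by rewrite !mxE ler0n.
  rewrite (bigD1 (Ordinal n0)) //= big1 => [|i i0];
    rewrite !mxE ?eqxx ?addr0 //.
  by rewrite (negbTE i0).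
(* Continuity is read off the variance written as a polynomial in the coordinates. *)
- apply: continuous_subspaceT; have -> : (fun v => variance W v^T) =
      (fun v : 'rV[R]_n => 2^-1 * \sum_j (\sum_i v ord0 i * W i j) * v ord0 j).
    apply/funext => v; rewrite /variance /qform trmxK mxE; congr (_ * _).
    by apply: eq_bigr => j _; rewrite !mxE.
  apply: continuous_mul; first exact: cst_continuous.
  apply: continuous_sum => j; apply: continuous_mul; last exact: contcoord.
  apply: continuous_sum => i; apply: continuous_mul; first exact: contcoord.
  exact: cst_continuous.
exists c^T; split=> // g sg; rewrite -[g]trmxK; apply: cmax.
by apply/mem_set/AP; rewrite trmxK.
Qed.

(** The first conjunct ensures that the inverses in [p_vec], [sigma2] and [kron_reduction] are
    genuine, since [invmx] returns a singular matrix unchanged and [0^-1] is [0]. *)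
Theorem theorem4p3 (R : realType) (n : nat) (Q : 'M[R]_n)
    (hn : (2 <= n)%N)
    (Qsym : Q^T = Q)
    (Qpsd : psd Q)
    (Qker : forall x : 'cV[R]_n,
        Q *m x = 0 <-> exists c : R, x = c *: ones R n) :
  let Omega := resistance_matrix Q in
  (forall V : {set 'I_n}, (2 <= #|V|)%N ->
     [/\ submat V V Omega \in unitmx,
         inv_total (submat V V Omega) != 0
       & submat (~: V) (~: V) Q \in unitmx]) /\
  (exists! f : 'cV[R]_n, is_maximizer Omega f) /\
  (forall f : 'cV[R]_n, is_maximizer Omega f ->
     let V := pos_support f in
     [/\ (2 <= #|V|)%N,
         variance Omega f = sigma2 Omega V,
         (forall i : 'I_n, i \notin V -> f i 0 = 0),
         subvec V f = p_vec Omega V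
       & subvec V f = resistance_curvature (kron_reduction Q V)]).
Proof.
move=> Omega; have sO := resistance_sym Qsym.
split=> [V V2|]; first split.
- exact: (sub_resistance_unit Qsym Qpsd Qker V2).
- exact: (sub_resistance_inv_total Qsym Qpsd Qker V2).
- exact: (sub_laplacian_unit Qsym Qpsd Qker (ltnW V2)).
split.
  have [f mf] := maximizer_exists Omega (ltnW hn).
  exists f; split=> // g; apply: maximizer_unique => //.
  exact: resistance_cond_negdef.
move=> f mf V; have V2 := maximizer_support_ge2 Qsym Qpsd Qker hn mf.
have uV := sub_resistance_unit Qsym Qpsd Qker V2.
have [fV vf] := maximizer_curvature sO mf uV.
have [[f0 _] _] := mf.
split=> // [i|].
  by rewrite inE -leNgt => fi; apply/eqP; rewrite eq_le fi f0.
by rewrite fV /resistance_curvature (resistance_kron Qsym Qpsd Qker) // ltnW.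
Qed.
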